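(* Let $X$ be a Hausdorff completely regular topological space which is not pre-Radon. Then $$C_{\Lambda^{\downarrow}}(X,\mathbb{R})>C_k(X,\mathbb{R}),$$ that is, the topology of $C_{\Lambda^{\downarrow}}(X,\mathbb{R})$ on $C(X,\mathbb{R})$ is strictly finer than the compact-open topology.
   Context: A finite (Borel) measure $\mu$ on $X$ is $\tau$-additive if for every family $\mathcal{P}$ of open subsets of $X$ and every $\varepsilon>0$ there is a finite subfamily $\mathcal{P}_\varepsilon\subseteq\mathcal{P}$ with $\mu(\bigcup\mathcal{P}_\varepsilon)\geq\mu(\bigcup\mathcal{P})-\varepsilon$. $X$ is pre-Radon if every finite $\tau$-additive measure $\mu$ on $X$ is a Radon measure, that is, $\mu(B)=\sup\{\mu(K):K\subseteq B,\ K\text{ compact}\}$ for every Borel subset $B$ of $X$. Let $\mathcal{O}_X$ be the set of open subsets of $X$. For a family $\mathcal{A}$ of subsets of $X$, $\mathcal{O}_X(\mathcal{A})$ is the family of open subsets of $X$ containing an element of $\mathcal{A}$. A compact family on $X$ is a nonempty $\mathcal{A}\subseteq\mathcal{O}_X$ with $\mathcal{O}_X(\mathcal{A})=\mathcal{A}$ such that whenever $\mathcal{P}\subseteq\mathcal{O}_X$ and $\bigcup\mathcal{P}\in\mathcal{A}$, there is a finite $\mathcal{P}_0\subseteq\mathcal{P}$ with $\bigcup\mathcal{P}_0\in\mathcal{A}$ (the family $\mathcal{O}_X$ itself is allowed). $\kappa(X)$ is the set of all compact families on $X$. A collection $\alpha\subseteq\kappa(X)$ is hereditarily self-joinable if for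 every $\mathcal{A}\in\alpha$ and every $A\in\mathcal{A}$ there is $\mathcal{G}\in\alpha$ with $A\in\mathcal{G}$ and $\mathcal{G}\vee\mathcal{G}\subseteq\mathcal{A}$, where $\mathcal{G}\vee\mathcal{G}=\{G_1\cap G_2:G_1,G_2\in\mathcal{G}\}$. $\Lambda^{\downarrow}(X)$ is the largest hereditarily self-joinable subset of $\kappa(X)$ (the union of all such collections, which is again hereditarily self-joinable). $C_{\Lambda^{\downarrow}}(X,\mathbb{R})$ is the set $C(X,\mathbb{R})$ of continuous functions $X\to\mathbb{R}$ with the topology having as subbase of open sets the sets $[\mathcal{A},U]=\{f: f^{-1}(U)\in\mathcal{A}\}$, for $\mathcal{A}\in\Lambda^{\downarrow}(X)$ and $U\subseteq\mathbb{R}$ open. $C_k(X,\mathbb{R})$ is $C(X,\mathbb{R})$ with the compact-open topology. *)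

(* Defs.v *)
From HB Require Import structures.
From mathcomp Require Import all_boot all_order all_algebra.
From mathcomp Require Import all_classical all_reals all_analysis.

Set Implicit Arguments.
Unset Strict Implicit.
Unset Printing Implicit Defensive.

Import Order.TTheory GRing.Theory Num.Theory.
Import numFieldNormedType.Exports.

Local Open Scope classical_set_scope.
Local Open Scope ring_scope.

Section BorelMeasures.
Context {X : topologicalType} {R : realType}.

(* Only the values of [mu] on Borel sets matter in the next two definitions. *)
Definition tau_additive (mu : set X -> \bar R) :=
  forall (P : set (set X)) (e : R), P `<=` open -> 0 < e ->
  exists P0 : set (set X), [/\ finite_set P0, P0 `<=` P &
    (mu (\bigcup_(U in P) U) - e%:E <= mu (\bigcup_(U in P0) U))%E].

Definition radon (mu : set X -> \bar R) :=
  forall B : set X, <<s open >> B ->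
  mu B = ereal_sup [set mu K | K in compactly_in B].

End BorelMeasures.

(* Measurable types of the library are pointed, so the Borel sigma-algebra of
   an arbitrary space [X] is packaged together with a point of [X]; the
   sigma-algebra itself does not depend on that point. *)
Definition pointed_at (X : topologicalType) (x0 : X) : Type := X.
HB.instance Definition _ (X : topologicalType) (x0 : X) :=
  Choice.on (pointed_at x0).
HB.instance Definition _ (X : topologicalType) (x0 : X) :=
  isPointed.Build (pointed_at x0) x0.

Definition borel (X : topologicalType) (x0 : X) :=
  @g_sigma_algebraType (pointed_at x0) (@open X).
HB.instance Definition _ (X : topologicalType) (x0 : X) :=
  Measurable.on (borel x0).

(* The quantification over [x0] is vacuous exactly when [X] is empty, in which
   case the only measure on [X] is zero, which is Radon. *)
Definition pre_radon (R : realType) (X : topologicalType) :=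
  forall (x0 : X) (mu : {finite_measure set (borel x0) -> \bar R}),
    @tau_additive X R mu -> @radon X R mu.

Section CompactFamilies.
Context {X : topologicalType}.
Implicit Types (A G : set (set X)) (alpha : set (set (set X))).

Definition open_supersets A : set (set X) :=
  [set U | open U /\ exists2 V, A V & V `<=` U].

Definition compact_family A :=
  [/\ A !=set0, A `<=` open, open_supersets A = A &
    forall P : set (set X), P `<=` open -> A (\bigcup_(U in P) U) ->
    exists P0 : set (set X),
      [/\ finite_set P0, P0 `<=` P & A (\bigcup_(U in P0) U)]].

Definition family_join G H : set (set X) :=
  [set G1 `&` G2 | G1 in G & G2 in H].

Definition hereditarily_self_joinable alpha :=
  alpha `<=` compact_family /\
  forall A, alpha A -> forall U, A U ->
    exists G, [/\ alpha G, G U & family_join G G `<=` A].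

End CompactFamilies.

Definition Lambda_down (X : topologicalType) : set (set (set X)) :=
  \bigcup_(alpha in @hereditarily_self_joinable X) alpha.

Lemma Lambda_down_hsj (X : topologicalType) :
  hereditarily_self_joinable (@Lambda_down X).
Proof.
split=> [A [alpha [ak _]] /ak //|A [alpha ha aA] U AU].
have [G [aG GU GA]] := ha.2 A aA U AU.
by exists G; split => //; exists alpha.
Qed.

Lemma Lambda_down_max (X : topologicalType) (alpha : set (set (set X))) :
  hereditarily_self_joinable alpha -> alpha `<=` @Lambda_down X.
Proof. by move=> ha A aA; exists alpha. Qed.

(* [continuousType X Y] carries no canonical topology; the aliases below equip
   it with the topology having the sets [A, U] (A in alpha, U open in Y) as a
   subbase, and with the compact-open topology, respectively. *)
Definition C_family (X : topologicalType) (alpha : set (set (set X)))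
  (Y : topologicalType) : Type := continuousType X Y.

Section FamilyOpenTopology.
Context (X : topologicalType) (alpha : set (set (set X))) (Y : topologicalType).

Definition family_open_sub (AU : set (set X) * set Y) :
    set (C_family alpha Y) :=
  [set f : continuousType X Y | AU.1 (f @^-1` AU.2)].

HB.instance Definition _ := Choice.on (C_family alpha Y).
HB.instance Definition _ := isSubBaseTopological.Build (C_family alpha Y)
  [set AU | alpha AU.1 /\ open AU.2] family_open_sub.

End FamilyOpenTopology.

Definition C_Lambda_down (X Y : topologicalType) := C_family (@Lambda_down X) Y.
HB.instance Definition _ (X Y : topologicalType) :=
  Topological.on (C_Lambda_down X Y).

Definition C_k (X Y : topologicalType) : Type :=
  @initial_topology (continuousType X Y) {compact-open, X -> Y}
    (fun f : continuousType X Y => f : X -> Y).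
HB.instance Definition _ (X Y : topologicalType) := Topological.on (C_k X Y).

(* Main.v *)
Require Import Defs.
From mathcomp Require Import all_boot all_order all_algebra.
From mathcomp Require Import all_classical all_reals all_analysis.
From mathcomp Require Import finmap ring lra.

(** Let [mu] be a finite tau-additive Borel measure that is not Radon.

    Every family [{U open | r < mu (U `&` V)}] with [V] open and [r < mu V] is
    compact by tau-additivity, and together these families are hereditarily
    self-joinable ([mass_family_hsj]): if [U] belongs to such a family, then by
    inclusion-exclusion two open sets that both fill more than the average of
    [r] and [mu (U `&` V)] inside [U `&` V] have an intersection that fills
    more than [r] of it. So they belong to Lambda_down, and so do the families
    [{U open | K `<=` U}] with [K] compact ([compact_hsj]), which yield the
    inclusion of the compact-open topology ([C_k_coarser]).

    The inclusion is strict. On a regular space, tau-additivity makes [mu]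
    outer regular and inner regular with respect to closed sets
    ([borel_mass_regular]). Hence if compact sets had measures arbitrarily
    close to [mu X], then [mu] would be Radon ([radon_of_tight]). As it is not,
    there is [r < mu X] such that every compact set has an open neighborhood of
    measure at most [r] ([not_radon_compact_bound]). Consider the set of
    continuous [f] such that [r < mu {x | f x < 1}]. It is open for the
    topology of Lambda_down and contains the zero function. If it were open for
    the compact-open topology, it would contain all the continuous functions
    that vanish on some compact set [K] ([C_k_open_compact]). But if [U] is an
    open neighborhood of [K] of measure at most [r], complete regularity
    provides a continuous [g] that is 0 on [K] and 1 outside [U]
    ([compact_closed_separator]), so that [{x | g x < 1} `<=` U]. *)

Set Implicit Arguments.
Unset Strict Implicit.
Unset Printing Implicit Defensive.

Import Order.TTheory GRing.Theory Num.Theory.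
Import numFieldNormedType.Exports.

Local Open Scope classical_set_scope.
Local Open Scope ring_scope.

(** * Compact sets, compact families and topologies on function spaces *)

Section CompactSets.
Context {X : topologicalType}.

(** Finite subcovers, for a space [X] that need not be pointed. *)
Lemma compact_finite_subcover (K : set X) (P : set (set X)) : compact K ->
  P `<=` open -> K `<=` \bigcup_(U in P) U ->
  exists P0 : set (set X),
    [/\ finite_set P0, P0 `<=` P & K `<=` \bigcup_(U in P0) U].
Proof.
move=> /compact_near_coveringP cK oP KP.
(* [F] is the filter of the finite subfamilies of [P], directed by inclusion. *)
pose fsub (Q : set (set X)) := finite_set Q /\ Q `<=` P.
pose F : set_system (set (set X)) :=
  filter_from fsub (fun Q => [set Q' | fsub Q' /\ Q `<=` Q']).
have FF : Filter F.
  apply: filter_from_filter; first by exists set0; split.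
  move=> Q Q' [fQ QP] [fQ' Q'P]; exists (Q `|` Q').
    by split; [rewrite finite_setU | rewrite subUset].
  by move=> S /= [fS]; rewrite subUset => -[].
have cov x : K x ->
    \forall x' \near x & Q \near F, (\bigcup_(U in Q) U) x'.
  move=> /KP[U PU Ux].
  exists (U, [set Q | fsub Q /\ [set U] `<=` Q]) => /=.
    split; first by apply: open_nbhs_nbhs; split; [exact: oP|].
    by exists [set U] => //; split; [exact: finite_set1|move=> _ ->].
  by move=> [y Q] /= [Uy [_ UQ]]; exists U => //; exact: UQ.
have [Q [fQ QP] QK] := cK _ F _ FF cov.
exists Q; split => //; apply: QK; split => //; split.
Qed.

Lemma compact_family_compact (K : set X) : compact K ->
  compact_family [set U | open U /\ K `<=` U].
Proof.
move=> cK; split.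
- by exists setT; split => //; exact: openT.
- by move=> U [].
- apply/seteqP; split=> [U [oU [V [_ KV] VU]]|U [oU KU]].
    by split => //; exact: subset_trans VU.
  by split => //; exists U.
- move=> P oP [_ KP].
  have [Q [fQ QP KQ]] := compact_finite_subcover cK oP KP.
  by exists Q; split => //; split => //; apply: bigcup_open => U /QP /oP.
Qed.

Lemma compact_hsj :
  hereditarily_self_joinable
    [set [set U | open U /\ K `<=` U] | K in @compact X].
Proof.
split=> [_ [K cK <-]|_ [K cK <-] U [oU KU]].
  exact: compact_family_compact.
exists [set U | open U /\ K `<=` U]; split => //; first by exists K.
move=> _ [G [oG KG] [H [oH KH] <-]]; split; first exact: openI.
by move=> x Kx; split; [exact: KG|exact: KH].
Qed.

Lemma C_family_open (alpha : set (set (set X))) (Y : topologicalType)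
    (A : set (set X)) (U : set Y) : alpha A -> open U ->
  open ([set f : continuousType X Y | A (f @^-1` U)] : set (C_family alpha Y)).
Proof.
move=> aA oU; pose C := @family_open_sub X alpha Y (A, U).
exists [set C]; last by rewrite bigcup_set1.
move=> _ ->; exists (fset1 (A, U)) => //; last by rewrite set_fset1 bigcap_set1.
by move=> i; rewrite inE => /eqP ->; apply: mem_set.
Qed.

Lemma C_k_coarser (alpha : set (set (set X))) (Y : topologicalType) :
  [set [set U | open U /\ K `<=` U] | K in @compact X] `<=` alpha ->
  (@open (C_k X Y) : set (set (continuousType X Y))) `<=`
  (@open (C_family alpha Y) : set (set (continuousType X Y))).
Proof.
move=> Ka _ [V oV <-].
pose h (f : C_family alpha Y) : {compact-open, X -> Y} :=
  (f : continuousType X Y).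
suff /continuousP : continuous h by apply.
move=> f; have FF : Filter (h x @[x --> f]).
  by apply: fmap_filter; exact: (@nbhs_filter (C_family alpha Y)).
apply/compact_open_cvgP => K U cK oU fKU.
apply: (@open_nbhs_nbhs (C_family alpha Y)); split.
  have -> : h @^-1` [set g | g @` K `<=` U] =
    [set f : continuousType X Y | [set U | open U /\ K `<=` U] (f @^-1` U)].
    apply/seteqP; split=> g /=.
      move=> gKU; split; last by move=> x Kx; apply: gKU; exists x.
      by apply: open_comp => // x _; exact: cts_fun.
    by move=> [_ KU] _ [x Kx <-]; exact: KU.
  by apply: C_family_open => //; apply: Ka; exists K.
by [].
Qed.

(** Membership in a set open for the compact-open topology depends only on the
    values on some compact set. *)
Lemma C_k_open_compact (Y : topologicalType) (W : set (continuousType X Y))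
    (f : continuousType X Y) :
  open (W : set (C_k X Y)) -> W f ->
  exists2 K, compact K &
    forall g : continuousType X Y, (forall x, K x -> f x = g x) -> W g.
Proof.
move=> [V oV <-] Vf.
(* It suffices that the filter generated by the functions that agree with [f]
   on a compact set converges to [f]. *)
pose F : set_system {compact-open, X -> Y} :=
  filter_from (@compact X)
    (fun K => [set g : X -> Y | forall x, K x -> f x = g x]).
have FF : Filter F.
  apply: filter_from_filter; first by exists set0; exact: compact0.
  move=> K L cK cL; exists (K `|` L); first exact: compactU.
  by move=> g /= fg; split=> x xK; apply: fg; [left|right].
have Ff : F --> (f : {compact-open, X -> Y}).
  apply/compact_open_cvgP => K U cK oU fKU.
  by exists K => // g fg _ [x Kx <-]; rewrite -fg//; apply: fKU; exists x.
have [K cK KV] : F V by apply: Ff; exact: open_nbhs_nbhs.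
by exists K => // g fg; exact: KV.
Qed.

End CompactSets.

(** Each point of [K] has an entourage that keeps it away from [C]; compactness
    makes a single entourage work for all of [K]. *)
Lemma compact_closed_entourage (T : uniformType) (K C : set T) : compact K ->
  closed C -> K `&` C = set0 ->
  exists2 E, entourage E & K `*` C `&` E = set0.
Proof.
move=> /compact_near_coveringP cK cC KC0.
(* A limit along [F] stands for a sufficiently small entourage. *)
pose F : set_system (set (T * T)) :=
  filter_from entourage (fun E => [set G | G `<=` E]).
have FF : Filter F.
  apply: filter_from_filter; first by exists setT; exact: filterT.
  move=> E E' entE entE'; exists (E `&` E'); first exact: filterI.
  by move=> G; rewrite /= subsetI.
have cov x : K x ->
    \forall x' \near x & E \near F, forall c, C c -> ~ E (x', c).
  move=> Kx.
  have nCx : nbhs x (~` C).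
    apply: open_nbhs_nbhs; split; first exact: closed_openC.
    by move=> Cx; have : set0 x by rewrite -KC0.
  move: nCx; rewrite -nbhs_entourageE => -[E entE EC].
  have eS : entourage (split_ent E) by exact: entourage_split_ent.
  exists (xsection (split_ent E) x, [set G | G `<=` split_ent E]).
    split => /=; last by exists (split_ent E).
    by rewrite -nbhs_entourageE; exists (split_ent E).
  move=> [y G] /= [/xsectionP Exy GE] c Cc /GE Eyc.
  have /EC : xsection E x c.
    by apply/xsectionP; apply: (@entourage_split _ y).
  by apply.
have [E entE EK] := cK _ F _ FF cov.
exists E => //; rewrite -subset0 => -[k c] [[/= Kk Cc] Ekc].
exact: (EK E (@subset_refl _ E) k Kk c Cc).
Qed.

Lemma compact_closed_separator (R : realType) (X : topologicalType)
    (K C : set X) : completely_regular_space X -> compact K -> closed C ->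
  K `&` C = set0 -> uniform_separator K C.
Proof.
move=> crX cK cC KC0.
pose X' := @completely_regular_uniformity.type R _ crX.
exact/(@uniform_separatorW X')/compact_closed_entourage.
Qed.

(** * Finite tau-additive Borel measures *)

Section BorelMass.
Context {R : realType} {X : topologicalType} {x0 : X}.
Variable mu : {finite_measure set (borel x0) -> \bar R}.
Implicit Types A B U V F K : set X.

(** The measure as a real-valued function; only its values on Borel sets are
    meaningful. *)
Definition mass (A : set X) : R := fine (mu A).

Lemma borel_open U : open U -> <<s open >> U.
Proof. exact: sub_sigma_algebra. Qed.

Lemma borelC A : <<s open >> A -> <<s open >> (~` A).
Proof. by move=> mA; apply: (@measurableC _ (borel x0)). Qed.

Lemma borelU A B : <<s open >> A -> <<s open >> B -> <<s open >> (A `|` B).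
Proof. by move=> mA mB; apply: (@measurableU _ (borel x0)). Qed.

Lemma borelI A B : <<s open >> A -> <<s open >> B -> <<s open >> (A `&` B).
Proof. by move=> mA mB; apply: (@measurableI _ (borel x0)). Qed.

Lemma borel_closed F : closed F -> <<s open >> F.
Proof.
move=> cF; rewrite -(setCK F); apply: borelC; apply: borel_open.
exact: closed_openC.
Qed.

Lemma massE A : <<s open >> A -> mu A = (mass A)%:E.
Proof.
by move=> mA; rewrite /mass fineK//; apply: fin_num_measure.
Qed.

Lemma le_mass A B : <<s open >> A -> <<s open >> B -> A `<=` B ->
  mass A <= mass B.
Proof.
move=> mA mB AB; rewrite -lee_fin -!massE//.
exact: (le_measure mu (mem_set (mA : @measurable _ (borel x0) A))
  (mem_set (mB : @measurable _ (borel x0) B)) AB).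
Qed.

Lemma massU A B : <<s open >> A -> <<s open >> B -> A `&` B = set0 ->
  mass (A `|` B) = mass A + mass B.
Proof.
move=> mA mB AB0; apply: EFin_inj; rewrite EFinD -!massE//; last exact: borelU.
exact: (measureU mu (mA : @measurable _ (borel x0) A)
  (mB : @measurable _ (borel x0) B) AB0).
Qed.

Lemma mass_subD A B : <<s open >> A -> <<s open >> B -> A `<=` B ->
  mass B = mass A + mass (B `&` ~` A).
Proof.
move=> mA mB AB; rewrite -massU//.
- by rewrite setUIr setUv setIT; congr mass; apply/esym/setUidr.
- by apply: borelI => //; exact: borelC.
- by rewrite setICA setICr setI0.
Qed.

Lemma massUI A B : <<s open >> A -> <<s open >> B ->
  mass (A `|` B) + mass (A `&` B) = mass A + mass B.
Proof.
move=> mA mB.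
have mAC := borelC mA; have mBC := borelC mB.
have -> : A `|` B = A `|` (~` A `&` B).
  by rewrite setUIr setUv setTI.
rewrite massU//; first last.
- by rewrite setIA setICr set0I.
- exact: borelI.
have -> : mass B = mass (A `&` B) + mass (~` A `&` B).
  rewrite -massU; first by rewrite -setIUl setUv setTI.
  - exact: borelI.
  - exact: borelI.
  - by rewrite setIACA setICr set0I.
by lra.
Qed.

Lemma mass0 : mass set0 = 0.
Proof. by rewrite /mass measure0. Qed.

Lemma mass_ge0 A : 0 <= mass A.
Proof. by rewrite /mass fine_ge0. Qed.

Lemma massU_le A B : <<s open >> A -> <<s open >> B ->
  mass (A `|` B) <= mass A + mass B.
Proof.
by move=> mA mB; rewrite -massUI//; have := mass_ge0 (A `&` B); lra.
Qed.

Lemma massC A : <<s open >> A -> mass A + mass (~` A) = mass setT.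
Proof.
by move=> mA; rewrite -massU ?setUv ?setICr//; exact: borelC.
Qed.

Hypothesis tau : @tau_additive X R mu.

Lemma tau_mass (P : set (set X)) (e : R) : P `<=` open -> 0 < e ->
  exists P0 : set (set X), [/\ finite_set P0, P0 `<=` P &
    mass (\bigcup_(U in P) U) - e <= mass (\bigcup_(U in P0) U)].
Proof.
move=> oP e0; have [Q [fQ QP]] := tau oP e0.
rewrite !massE; first by move=> h; exists Q.
- by apply: borel_open; apply: bigcup_open => U /QP /oP.
- by apply: borel_open; exact: bigcup_open.
Qed.

(** The open sets that meet [V] in a set of measure greater than [r]. *)
Definition mass_family (V : set X) (r : R) : set (set X) :=
  [set U | open U /\ r < mass (U `&` V)].

Lemma mass_family_compact V r : open V -> r < mass V ->
  compact_family (mass_family V r).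
Proof.
move=> oV rV; split.
- by exists setT; split; [exact: openT|rewrite setTI].
- by move=> U [].
- apply/seteqP; split=> [U [oU [W [oW rW] WU]]|U [oU rU]].
    split=> //; apply: (lt_le_trans rW); apply: le_mass.
    + by apply: borel_open; exact: openI.
    + by apply: borel_open; exact: openI.
    + exact: setSI.
  by split => //; exists U.
- move=> P oP [_]; set s := mass _ => rs.
  pose PV := [set U `&` V | U in P].
  have oPV : PV `<=` open by move=> _ [U PU <-]; apply: openI => //; exact: oP.
  have rs0 : 0 < (s - r) / 2 by lra.
  have [Q [fQ QP]] := tau_mass oPV rs0.
  have -> : \bigcup_(U in PV) U = (\bigcup_(U in P) U) `&` V.
    by rewrite bigcup_image setI_bigcupl.
  rewrite -/s => sQ.
  (* [g] lifts each member of [Q] to a member of [P] with that trace on [V]. *)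
  have /choice[g gP] : forall W, exists U, Q W -> P U /\ U `&` V = W.
    move=> W; have [/QP[U PU UW]|nQW] := pselect (Q W); last by exists W.
    by exists U.
  have ogQ : open (\bigcup_(U in g @` Q) U).
    by apply: bigcup_open => _ [W QW <-]; have [/oP] := gP _ QW.
  exists (g @` Q); split.
  + exact: finite_image.
  + by move=> _ [W QW <-]; have [] := gP _ QW.
  split => //.
  have -> : (\bigcup_(U in g @` Q) U) `&` V = \bigcup_(W in Q) W.
    rewrite bigcup_image setI_bigcupl; apply: eq_bigcupr => W QW.
    by have [] := gP _ QW.
  by apply: lt_le_trans sQ; lra.
Qed.

Lemma mass_family_hsj : hereditarily_self_joinable
  [set mass_family Vr.1 Vr.2 | Vr in [set Vr | open Vr.1 /\ Vr.2 < mass Vr.1]].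
Proof.
split=> [_ [[V r] [/= oV rV] <-]|_ [[V r] [/= oV rV] <-] U [oU rU]].
  exact: mass_family_compact.
have oUV : open (U `&` V) by exact: openI.
pose s := (r + mass (U `&` V)) / 2.
have sU : s < mass (U `&` V) by rewrite /s; lra.
exists (mass_family (U `&` V) s); split.
- by exists (U `&` V, s).
- by split => //; rewrite setIA setIid.
move=> _ [G [oG sG] [H [oH sH] <-]]; split; first exact: openI.
have mUV := borel_open oUV.
have mG := borelI (borel_open oG) mUV.
have mH := borelI (borel_open oH) mUV.
have := massUI mG mH; rewrite setIACA setIid => GH.
have GHU : mass ((G `&` (U `&` V)) `|` (H `&` (U `&` V))) <= mass (U `&` V).
  by apply: le_mass => //; [exact: borelU|move=> x [] []].
have : mass (G `&` H `&` (U `&` V)) <= mass (G `&` H `&` V).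
  apply: le_mass; last by move=> x [GHx [_ Vx]].
    by apply: borelI => //; apply: borel_open; exact: openI.
  by apply: borel_open; apply: openI => //; exact: openI.
by rewrite /s in sG sH *; lra.
Qed.

(** By regularity, [U] is the union of the open sets whose closure is contained
    in [U], so finitely many of these closures fill [U] up to [e]. *)
Lemma mass_regular_open (regX : regular_space X) U (e : R) :
  open U -> 0 < e -> exists V, [/\ open V, ~` U `<=` V & mass (U `&` V) <= e].
Proof.
move=> oU e0.
pose P := [set W : set X | open W /\ closure W `<=` U].
have oP : P `<=` open by move=> W [].
have [Q [fQ QP]] := tau_mass oP e0.
have -> : \bigcup_(W in P) W = U.
  apply/seteqP; split=> [x [W [_ WU] Wx]|x Ux].
    exact/WU/subset_closure.
  have [W nW WU] := regX x U (open_nbhs_nbhs (conj oU Ux)).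
  exists (W°); last exact: nW.
  split; first exact: open_interior.
  exact: subset_trans (closureS (@interior_subset _ W)) WU.
move=> UQ; pose F := \bigcup_(W in Q) closure W.
have cF : closed F by apply: closed_bigcup => // W _; exact: closed_closure.
have FU : F `<=` U by move=> x [W /QP[_ WU] /WU].
have QF : \bigcup_(W in Q) W `<=` F.
  by move=> x [W QW Wx]; exists W => //; exact: subset_closure.
exists (~` F); split; [exact: closed_openC|exact: subsetC|].
have mF := borel_closed cF; have mU := borel_open oU.
have : mass (\bigcup_(W in Q) W) <= mass F.
  by apply: le_mass => //; apply: borel_open; apply: bigcup_open => W /QP[].
have : mass U = mass F + mass (U `&` ~` F).
  exact: mass_subD.
by lra.
Qed.

(** Regularity of a set [A] as a condition that is symmetric in [A] and its
    complement: the open sets [U] and [V] cover [A] and its complement and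
    overlap in a set of small measure. Equivalently, [A] lies between the closed
    set [~` V] and the open set [U], whose difference has small measure. *)
Definition mass_regular (A : set X) := forall e : R, 0 < e ->
  exists U V, [/\ open U, open V, A `<=` U, ~` A `<=` V & mass (U `&` V) <= e].

(** The witness [W] is the intersection of the first [n] of the [V k]. Its part
    inside the union of the first [n] of the [U k] is contained in the union of
    the [U k `&` V k] with [k < n], so its measure is at most the sum of the
    [e / 2 ^+ k.+1] with [k < n]. *)
Lemma mass_regular_fin_cover (A : nat -> set X) (e : R) (n : nat)
    (U V : nat -> set X) : 0 <= e ->
  (forall k, [/\ open (U k), open (V k), A k `<=` U k, ~` A k `<=` V k &
     mass (U k `&` V k) <= e / (2 ^+ k.+1)]) ->
  exists W, [/\ open W, \bigcap_k (~` A k) `<=` W &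
    mass ((\bigcup_(k in `I_n) U k) `&` W) <= e * (1 - 1 / 2 ^+ n)].
Proof.
move=> e0 UV; elim: n => [|n [W [oW AW mW]]].
  exists setT; split => //; first exact: openT.
  by rewrite II0 bigcup_set0 set0I mass0 expr0 divr1 subrr mulr0.
have [oU oV AU AV mUV] := UV n.
have oUn : open (\bigcup_(k in `I_n) U k).
  by apply: bigcup_open => k _; have [] := UV k.
exists (W `&` V n); split; first exact: openI.
  by move=> x Ax; split; [exact: AW|apply: AV; exact: Ax].
set S := \bigcup_(k in `I_n) U k in oUn mW *.
have -> : e * (1 - 1 / 2 ^+ n.+1) = e * (1 - 1 / 2 ^+ n) + e / 2 ^+ n.+1.
  by rewrite exprS; field; rewrite expf_neq0// pnatr_eq0.
have mSW : <<s open >> (S `&` W) by apply: borel_open; exact: openI.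
have mUVn : <<s open >> (U n `&` V n) by apply: borel_open; exact: openI.
apply: le_trans (lerD mW mUV); apply: le_trans (massU_le mSW mUVn).
apply: le_mass.
- apply: borel_open; apply: openI; last exact: openI.
  by apply: bigcup_open => k _; have [] := UV k.
- exact: borelU.
- move=> x [[k /= +] Ukx [Wx Vx]]; rewrite ltnS leq_eqVlt.
  case/orP => [/eqP kn|kn]; first by subst k; right.
  by left; split => //; exists k.
Qed.

Lemma mass_regular_bigcup (A : nat -> set X) :
  (forall k, mass_regular (A k)) -> mass_regular (\bigcup_k A k).
Proof.
move=> rA e e0.
have d0 k : 0 < (e / 2) / 2 ^+ k.+1 by rewrite !divr_gt0// exprn_gt0.
have /choice[U /choice[V UV]] := fun k => rA k _ (d0 k).
have oU k : open (U k) by have [] := UV k.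
have oUU : range U `<=` open by move=> _ [k _ <-].
(* Finitely many [U k] fill the union of all of them up to [e / 2], so only the
   first [n] of the [V k] need to be intersected. *)
have [|Q [fQ QU]] := @tau_mass (range U) (e / 2) oUU; first by lra.
rewrite bigcup_image => mQ.
have [n Qn] : exists n, Q `<=` [set U k | k in `I_n].
  have /choice[g gP] : forall W, exists k, Q W -> W = U k.
    move=> W; have [/QU[k _ <-]|nQW] := pselect (Q W); last by exists 0%N.
    by exists k.
  have /finite_fsetP[S QS] := finite_image g fQ.
  exists (\max_(k <- S) k).+1 => W QW; exists (g W); last by rewrite -gP.
  rewrite /= ltnS; apply: (@leq_bigmax_seq _ _ xpredT id) => //.
  have : (g @` Q) (g W) by exists W.
  by rewrite QS.
have e20 : 0 <= e / 2 by lra.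
have [W [oW AW mW]] := mass_regular_fin_cover n e20 UV.
have oUn : open (\bigcup_(k in `I_n) U k) by apply: bigcup_open.
have oUT : open (\bigcup_k U k) by apply: bigcup_open.
exists (\bigcup_k U k), W; split => //.
- by move=> x [k _ Akx]; exists k => //; have [_ _ + _ _] := UV k; apply.
- by rewrite setC_bigcup.
set S := \bigcup_(k in `I_n) U k in mW oUn.
set T := \bigcup_k U k in mQ oUT *.
have mS := borel_open oUn; have mT := borel_open oUT.
have mWo := borel_open oW.
have QS : mass (\bigcup_(V in Q) V) <= mass S.
  apply: le_mass => //; last by move=> x [_ /Qn[k kn <-] Ukx]; exists k.
  by apply: borel_open; apply: bigcup_open => _ /QU[k _ <-].
have ST : S `<=` T by move=> x [k _ Ukx]; exists k.
have TS : mass T = mass S + mass (T `&` ~` S).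
  exact: mass_subD.
have mSW : <<s open >> (S `&` W) by exact: borelI.
have mTS : <<s open >> (T `&` ~` S) by apply: borelI => //; exact: borelC.
have : mass (T `&` W) <= mass (S `&` W) + mass (T `&` ~` S).
  apply: le_trans (massU_le mSW mTS); apply: le_mass.
  - exact: borelI.
  - exact: borelU.
  - by move=> x [Tx Wx]; have [Sx|nSx] := pselect (S x); [left|right].
have : e / 2 * (1 - 1 / 2 ^+ n) <= e / 2.
  by rewrite ler_piMr// gerBl divr_ge0// exprn_ge0.
by lra.
Qed.

Lemma borel_mass_regular (regX : regular_space X) B :
  <<s open >> B -> mass_regular B.
Proof.
apply: smallest_sub; last first.
  move=> U oU e e0; have [V [oV UV mUV]] := mass_regular_open regX oU e0.
  by exists U, V; split.
split.
- move=> e e0; exists set0, setT; split => //.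
  + exact: open0.
  + exact: openT.
  + by rewrite set0I mass0 ltW.
- move=> A rA e /rA[U [V [oU oV AU AV mUV]]].
  by exists V, U; rewrite setTD setCK setIC; split.
- exact: mass_regular_bigcup.
Qed.

Lemma radon_of_tight (hausX : hausdorff_space X) (regX : regular_space X) :
  (forall e : R, 0 < e -> exists2 K, compact K & mass setT - e <= mass K) ->
  @radon X R mu.
Proof.
move=> tight B mB; apply/eqP; rewrite eq_le; apply/andP; split; last first.
  apply: ub_ereal_sup => _ [K [KB cK] <-].
  have mK := borel_closed (compact_closed hausX cK).
  by rewrite !massE// lee_fin; exact: le_mass.
rewrite massE//; apply/lee_subgt0Pr => e e0.
have e20 : 0 < e / 2 by lra.
have [U [V [oU oV BU BV mUV]]] := borel_mass_regular regX mB e20.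
have [K cK mK] := tight _ e20.
(* The compact approximation of [B] is [K `&` ~` V]. *)
have cVK : compact (K `&` ~` V).
  by apply: compact_closedI => //; exact: open_closedC.
have bK := borel_closed (compact_closed hausX cK).
have bVK := borel_closed (compact_closed hausX cVK).
apply: (@le_trans _ _ (mu (K `&` ~` V))); last first.
  apply: ereal_sup_ubound; exists (K `&` ~` V) => //; split => //.
  by move=> x [_]; apply: contra_notP => /BV.
rewrite massE// -EFinD lee_fin.
have bUV : <<s open >> (U `&` V) by apply: borel_open; exact: openI.
have bKC := borelC bK.
have := massC bK.
have := massU_le bVK bUV.
have := massU_le (borelU bVK bUV) bKC.
have : mass B <= mass (K `&` ~` V `|` U `&` V `|` ~` K).
  apply: le_mass => //; first by apply: borelU => //; exact: borelU.
  move=> x Bx; have [Kx|nKx] := pselect (K x); last by right.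
  left; have [Vx|nVx] := pselect (V x); last by left.
  by right; split => //; exact: BU.
by lra.
Qed.

Lemma not_radon_compact_bound (hausX : hausdorff_space X)
    (regX : regular_space X) : ~ @radon X R mu ->
  exists2 r, r < mass setT &
    forall K, compact K -> exists U, [/\ open U, K `<=` U & mass U <= r].
Proof.
move=> nrad.
have [e e0 eK] : exists2 e : R, 0 < e &
    forall K, compact K -> mass K < mass setT - e.
  apply: contrapT => h; apply: nrad; apply: radon_of_tight => // e e0.
  apply: contrapT => hK; apply: h; exists e => // K cK.
  by rewrite ltNge; apply/negP => mK; apply: hK; exists K.
exists (mass setT - e / 2); first by lra.
move=> K cK; have bK := borel_closed (compact_closed hausX cK).
have e20 : 0 < e / 2 by lra.
have [U [V [oU oV KU KV mUV]]] := borel_mass_regular regX bK e20.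
exists U; split => //.
have bUV : <<s open >> (U `&` V) by apply: borel_open; exact: openI.
have : mass U <= mass (K `|` (U `&` V)).
  apply: le_mass; [exact: borel_open|exact: borelU|].
  move=> x Ux; have [Kx|nKx] := pselect (K x); first by left.
  by right; split => //; exact: KV.
by have := massU_le bK bUV; have := eK K cK; lra.
Qed.

End BorelMass.

(** * Strictness of the inclusion *)

Theorem theorem5p2 (R : realType) (X : topologicalType)
    (hausX : hausdorff_space X) (crX : completely_regular_space X)
    (nprX : ~ pre_radon R X) :
  (@open (C_k X R) : set (set (continuousType X R))) `<`
  (@open (C_Lambda_down X R) : set (set (continuousType X R))).
Proof.
split.
  by apply: C_k_coarser; apply: Lambda_down_max; exact: compact_hsj.
have [x0 [mu [tau nrad]]] : exists x0 : X,
    exists mu : {finite_measure set (borel x0) -> \bar R},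
    @tau_additive X R mu /\ ~ @radon X R mu.
  apply: contrapT => h; apply: nprX => x0 mu tau; apply: contrapT => nrad.
  by apply: h; exists x0, mu.
have regX := @completely_regular_regular R X crX.
have [r rT rK] := not_radon_compact_bound tau hausX regX nrad.
have oA : open ([set f : continuousType X R |
    mass_family mu setT r (f @^-1` [set y | y < 1])] : set (C_Lambda_down X R)).
  apply: C_family_open; last exact: open_lt.
  apply: (Lambda_down_max (mass_family_hsj tau)).
  by exists (setT, r) => //=; split => //; exact: openT.
(* The zero function belongs to this set, as the preimage is all of [X]. *)
move=> /(_ _ oA) /(@C_k_open_compact _ _ _ (cst 0)) [].
  split.
    by apply: open_comp; [move=> x _; exact: cvg_cst|exact: open_lt].
  rewrite setIT (_ : _ @^-1` _ = setT)//.
  by apply/seteqP; split => // x _ /=; exact: ltr01.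
move=> K cK; have [U [oU KU mU]] := rK K cK.
have KUC0 : K `&` ~` U = set0 by apply/disjoints_subset; rewrite setCK.
have /(@uniform_separatorP _ R)[f [cf _ f0 f1]] :=
  compact_closed_separator R crX cK (open_closedC oU) KUC0.
pose g : continuousType X R := mkcts cf.
move=> /(_ g)[]; first by move=> x Kx; rewrite /= [RHS]f0//; exists x.
move=> og; rewrite setIT ltNge => /negP; apply.
apply: le_trans mU; apply: le_mass; [exact: borel_open|exact: borel_open|].
move=> x /= fx1; apply: contrapT => nUx.
have f1x : f x = 1 by apply: f1; exists x.
by move: (fx1 : f x < 1); rewrite f1x ltxx.
Qed.
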